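(* Let $X$ be a countable H-separable Tychonoff space and let $Y$ be a countable Tychonoff space with $\pi w(Y)<\mathfrak{b}$. Then $X\times Y$ is S-separable.
   Context: A space $X$ is S-separable if for every sequence $(Y_n)_{n\in\mathbb{N}}$ of dense subspaces of $X$ there exists a sequence $(F_n)_{n\in\mathbb{N}}$ such that each $F_n$ is a finite subset of $Y_n$ and for each finite collection $\mathcal{F}$ of nonempty open sets of $X$ there exists $n\in\mathbb{N}$ with $U\cap F_n\neq\emptyset$ for all $U\in\mathcal{F}$. A space $X$ is H-separable if for every sequence $(Y_n)$ of dense subspaces of $X$ there exists a sequence $(F_n)$ such that each $F_n$ is a finite subset of $Y_n$ and every nonempty open set of $X$ intersects $F_n$ for all but finitely many $n$. A $\pi$-base of $X$ is a collection $\mathcal{B}$ of open sets such that every nonempty open set of $X$ contains a nonempty member of $\mathcal{B}$; $\pi w(X)$ is the minimal cardinality of a $\pi$-base of $X$. $\mathfrak{b}$ is the bounding number: the least cardinality of a subset of $\mathbb{N}^{\mathbb{N}}$ that is unbounded with respect to $\le^*$, where $f\le^* g$ means $f(n)\le g(n)$ for all but finitely many $n$. *)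

(* Defs.v *)
From mathcomp Require Import all_boot all_order all_algebra.
From mathcomp Require Import all_classical all_reals all_analysis.

Set Implicit Arguments.
Unset Strict Implicit.
Unset Printing Implicit Defensive.

Local Open Scope classical_set_scope.
Local Open Scope card_scope.

Definition tychonoff_space (X : topologicalType) :=
  hausdorff_space X /\ completely_regular_space X.

Definition H_separable (X : topologicalType) :=
  forall Y : nat -> set X, (forall n, dense (Y n)) ->
  exists F : nat -> set X,
    (forall n, finite_set (F n) /\ F n `<=` Y n) /\
    (forall U : set X, open U -> U !=set0 ->
      \forall n \near \oo, U `&` F n !=set0).

Definition S_separable (X : topologicalType) :=
  forall Y : nat -> set X, (forall n, dense (Y n)) ->
  exists F : nat -> set X,
    (forall n, finite_set (F n) /\ F n `<=` Y n) /\
    (forall UU : set (set X), finite_set UU ->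
      (forall U, UU U -> open U /\ U !=set0) ->
      exists n, forall U, UU U -> U `&` F n !=set0).

Definition pi_base (X : topologicalType) (B : set (set X)) :=
  (forall V, B V -> open V) /\
  (forall U : set X, open U -> U !=set0 ->
    exists V, [/\ B V, V !=set0 & V `<=` U]).

Definition le_star (f g : nat -> nat) := \forall n \near \oo, (f n <= g n)%N.

Definition unbounded (D : set (nat -> nat)) :=
  ~ exists g, forall f, D f -> le_star f g.

(* The cardinal numbers pi w(X) and b are represented by sets having that
   cardinality: a member of least cardinality of the family of all pi-bases,
   resp. of all unbounded families. The choice of the member is immaterial up
   to equipotence. *)
Definition least_card T (P : set (set T)) (A : set T) :=
  P A /\ forall B, P B -> A #<= B.

Lemma least_card_ex T (P : set (set T)) : P !=set0 -> exists A, least_card P A.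
Proof.
move=> [A0 PA0].
pose Q (S : set (set T -> T)) := (forall g A, S g -> P A -> A (g A)) /\
  (forall A g h, P A -> S g -> S h -> g A = h A -> g = h).
have [|S [[SP Sinj] Smax]] := @Zorn_bigcup _ Q.
  move=> F FQ Ftot; split.
    by move=> g A [S FS Sg]; exact: (FQ _ FS).1.
  move=> A g h PA [S FS Sg] [S' FS' S'h].
  have [SS'|S'S] := Ftot _ _ FS FS'.
    by apply: (FQ _ FS').2 => //; exact: SS'.
  by apply: (FQ _ FS).2 => //; exact: S'S.
have [A PA AS] : exists2 A, P A & A `<=` [set g A | g in S].
  apply: contrapT => /forall2NP noA.
  have {}noA A : P A -> exists x, A x /\ ~ [set g A | g in S] x.
    move=> PA; have [//|/existsNP[x /not_implyP[Ax Sx]]] := noA A.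
    by exists x.
  have [x0 _] := noA _ PA0.
  have /choice[g gP] A : exists x, P A -> A x /\ ~ [set g A | g in S] x.
    by have [/noA[x]|nPA] := pselect (P A); [exists x | exists x0].
  apply: (Smax (g |` S)).
    rewrite properEneq; split; last by move=> h; right.
    apply/eqP => SE; have Sg : S g by rewrite SE; left.
    by have [_] := gP _ PA0; apply; exists g.
  split=> [h A|A h k PA]; rewrite /setU /=; first move=> [->|Sh] PA.
  - by have [] := gP _ PA.
  - exact: (SP h A).
  have [_ gNS] := gP _ PA.
  move=> [->|Sh] [->|Sk] // E.
  - by exfalso; apply: gNS; exists k.
  - by exfalso; apply: gNS; exists h.
  - exact: Sinj E.
exists A; split=> // B PB.
apply: (card_le_trans (subset_card_le AS)).
apply: (card_le_trans (card_image_le _ _)).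
have SB : [set g B | g in S] `<=` B by move=> _ [g Sg <-]; exact: (SP g B).
apply: card_le_trans (subset_card_le SB).
suff: [set g B | g in S] #= S by rewrite card_eq_le => /andP[].
by apply: inj_card_eq => g h /set_mem Sg /set_mem Sh; exact: Sinj.
Qed.

Lemma pi_base_ex (X : topologicalType) : @pi_base X !=set0.
Proof.
exists (@open X); split=> [//|U oU U0]; exists U; split=> //.
Qed.

Lemma unbounded_ex : unbounded !=set0.
Proof.
exists setT => -[g /(_ (fun n => (g n).+1) I) [N _ /(_ N (leqnn N))]] /=.
by rewrite ltnn.
Qed.

Definition pi_weight (X : topologicalType) : set (set X) :=
  sval (cid (least_card_ex (pi_base_ex X))).

Arguments pi_weight : clear implicits.

Definition bounding_number : set (nat -> nat) :=
  sval (cid (least_card_ex unbounded_ex)).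

Definition card_lt T U (A : set T) (B : set U) := (A #<= B) && ~~ (B #<= A).

Lemma pi_weightP (X : topologicalType) : least_card (@pi_base X) (pi_weight X).
Proof. exact: svalP. Qed.

Lemma bounding_numberP : least_card unbounded bounding_number.
Proof. exact: svalP. Qed.

(* Main.v *)
Require Import Defs.
From mathcomp Require Import all_boot all_order all_algebra.
From mathcomp Require Import finmap.
From mathcomp Require Import all_classical all_reals all_analysis.

(** In fact [X * Y] is H-separable, and H-separability implies S-separability.
    Let [D n] be dense in [X * Y] and enumerate the countable set [X * Y]. For
    each nonempty [V] in a pi-base of [Y], the projections to [X] of the sets
    [D n `&` (setT `*` V)] are dense; H-separability of [X] yields finite
    selections from them, which lift to finite subsets of the
    [D n `&` (setT `*` V)], contained in the first [f_V n] elements of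
    [X * Y]. There are fewer than b functions [f_V], so a single [g] eventually
    dominates each of them, and [F n] can be taken to be the elements of [D n]
    among the first [g n] ones. *)

Local Open Scope classical_set_scope.
Local Open Scope card_scope.

(** The same selection works: finitely many cofinite sets of indices have a common element. *)
Lemma H_separable_S_separable (X : topologicalType) :
  H_separable X -> S_separable X.
Proof.
move=> HX D dD; have [F [FD FP]] := HX D dD; exists F; split=> // UU + UUP.
move=> /finite_fsetP[A UUE].
have : \forall n \near \oo, (\bigcap_(U in [set` A]) [set m | U `&` F m !=set0]) n.
  apply: filter_bigI => U AU.
  have /UUP[oU U0] : UU U by rewrite UUE.
  exact: FP.
move=> [N _ /(_ N (leqnn N)) FN]; exists N => U; rewrite UUE => AU.
exact: FN.
Qed.

(** Contrapositive of the minimality of [bounding_number] among unbounded families. *)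
Lemma small_family_bounded (A : set (nat -> nat)) :
  ~~ (bounding_number #<= A) -> exists g, forall f, A f -> le_star f g.
Proof.
move=> bA; apply: contrapT => unbA; move/negP: bA; apply.
exact: bounding_numberP.2.
Qed.

Lemma open_setX (X Y : topologicalType) (U : set X) (V : set Y) :
  open U -> open V -> open (U `*` V).
Proof.
move=> oU oV; rewrite openE => -[x y] [/= Ux Vy].
by exists (U, V) => //=; split; apply: open_nbhs_nbhs.
Qed.

Lemma open_prod_sub (X Y : topologicalType) (W : set (X * Y)) :
  open W -> W !=set0 -> exists U V,
    [/\ open U, U !=set0, open V, V !=set0 & U `*` V `<=` W].
Proof.
move=> oW [[x y] Wxy].
have [[A B] /= [xA yB] ABW] : nbhs (x, y) W by apply: open_nbhs_nbhs.
exists A^°, B^°; split; try exact: open_interior.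
- by exists x.
- by exists y.
- by move=> [a b] [/= /interior_subset Aa /interior_subset Bb]; apply: ABW.
Qed.

(** For [U] open and nonempty, density of [D] is applied to the open box with sides [U] and [V]. *)
Lemma dense_fst_slice (X Y : topologicalType) (D : set (X * Y)) (V : set Y) :
  dense D -> open V -> V !=set0 -> dense (fst @` (D `&` (setT `*` V))).
Proof.
move=> dD oV [y Vy] U [x Ux] oU.
have [|[a b] [[/= Ua Vb] Dab]] := dD (U `*` V) _ (open_setX _ _ _ _ oU oV).
  by exists (x, y).
by exists a; split=> //; exists (a, b).
Qed.

(** The value [f n] is the maximum of [e] over one lift per point of a finite selection fixed before
    [U], so one [f] serves every [U]. *)
Lemma H_separable_slice_bound (X Y : topologicalType) (e : X * Y -> nat)
    (D : nat -> set (X * Y)) (V : set Y) :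
  H_separable X -> (forall n, dense (D n)) -> open V -> V !=set0 ->
  exists f : nat -> nat, forall U : set X, open U -> U !=set0 ->
    \forall n \near \oo, exists p, [/\ D n p, U p.1, V p.2 & (e p <= f n)%N].
Proof.
move=> HX dD oV V0.
have [F [FE FP]] := HX _ (fun n => dense_fst_slice _ _ _ _ (dD n) oV V0).
have /choice[f fP] n : exists N, forall x, F n x ->
    exists p, [/\ D n p, p.1 = x, V p.2 & (e p <= N)%N].
  have [/finite_fsetP[A FA] FnE] := FE n.
  have /choice[k kP] x : exists m, F n x ->
      exists p, [/\ D n p, p.1 = x, V p.2 & e p = m].
    have [/FnE[p [Dp [_ Vp]] <-]|nFx] := pselect (F n x); last by exists 0%N.
    by exists (e p) => _; exists p.
  exists (\max_(x <- A) k x)%N => x Fx.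
  have [p [Dp px Vp epk]] := kP x Fx; exists p; split=> //.
  rewrite epk; apply: leq_bigmax_seq => //.
  by rewrite FA in Fx.
exists f => U oU U0; apply: filterS (FP U oU U0) => n [x [Ux /fP[p [Dp px Vp ep]]]].
by exists p; split=> //; rewrite px.
Qed.

Lemma prod_H_separable (X Y : topologicalType) (B : set (set Y)) :
  countable [set: X] -> countable [set: Y] -> H_separable X ->
  pi_base B -> ~~ (bounding_number #<= B) ->
  H_separable (X * Y)%type.
Proof.
move=> cX cY HX [oB Bsub] bB D dD.
have /countable_injP[e] := countableX cX cY.
rewrite setXTT => einj.
have /choice[f fP] V : exists h : nat -> nat, B V -> V !=set0 ->
    forall U : set X, open U -> U !=set0 ->
    \forall n \near \oo, exists p, [/\ D n p, U p.1, V p.2 & (e p <= h n)%N].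
  have [[/oB oV V0]|nV] := pselect (B V /\ V !=set0).
    by have [h hP] := H_separable_slice_bound _ _ e D V HX dD oV V0; exists h.
  (* Arbitrary value for [V] empty or outside [B]. *)
  by exists (fun=> 0%N) => BV V0; case: nV.
have [g gP] : exists g, forall h, (f @` B) h -> le_star h g.
  apply: small_family_bounded; apply: contra bB => bfB.
  exact: card_le_trans bfB (card_image_le _ _).
(* The successor turns the bound [e p <= g n] into a strict one; injectivity of [e] makes the
   preimage finite. *)
exists (fun n => D n `&` e @^-1` `I_(g n).+1); split=> [n|W oW W0].
  split; last by move=> p [].
  apply: (@sub_finite_set _ _ (e @^-1` `I_(g n).+1)); first by move=> p [].
  by apply: finite_preimage (finite_II _) => p q _ _; apply: einj; rewrite inE.
have [U [V0 [oU U0 oV0 V00 UVW]]] := open_prod_sub _ _ _ oW W0.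
have [V [BV V_neq0 VV0]] := Bsub _ oV0 V00.
have fg : le_star (f V) g by apply: gP; exists V.
apply: filterS2 fg (fP V BV V_neq0 U oU U0) => n fgn [p [Dp Up Vp ep]].
exists p; split; first by apply: UVW; split=> //; exact: VV0.
by split=> //=; rewrite ltnS; exact: leq_trans ep fgn.
Qed.

Theorem corollary3p10 (X Y : topologicalType)
  (X_countable : countable [set: X]) (X_tychonoff : tychonoff_space X)
  (X_Hsep : H_separable X)
  (Y_countable : countable [set: Y]) (Y_tychonoff : tychonoff_space Y)
  (Y_pi_weight : card_lt (pi_weight Y) bounding_number) :
  S_separable (X * Y)%type.
Proof.
apply: H_separable_S_separable.
have /andP[_ bY] := Y_pi_weight.
exact: prod_H_separable X_countable Y_countable X_Hsep (pi_weightP Y).1 bY.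
Qed.
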